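(* Let $f(x,y) = (x + g_1(y),\, h(x,y))$ be a homeomorphism of the two-dimensional torus $\mathbb{T}^2$ that preserves the Haar measure, where $g_1$ is a continuous function from $\mathbb{T}$ to $\mathbb{T}$ and $h$ is a function from $\mathbb{T}^2$ to $\mathbb{T}$. Then there exists a continuous function $g_2$ from $\mathbb{T}$ to $\mathbb{T}$ such that either $$f(x,y) = \bigl(x + g_1(y),\, g_2(x + g_1(y)) + y\bigr) \quad \text{for all } (x,y) \in \mathbb{T}^2,$$ or $$f(x,y) = \bigl(x + g_1(y),\, g_2(x + g_1(y)) - y\bigr) \quad \text{for all } (x,y) \in \mathbb{T}^2.$$
   Context: $\mathbb{T} = \mathbb{R}/\mathbb{Z}$ is the circle group, written additively, and $\mathbb{T}^2 = \mathbb{T} \times \mathbb{T}$. A homeomorphism $f$ preserves a measure $\mu$ if $\mu(f^{-1}(B)) = \mu(B)$ for every Borel set $B$. *)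

(* Defs.v *)
(* MathComp-Analysis; the reals are an arbitrary [R : realType]. *)
From HB Require Import structures.
From mathcomp Require Import all_boot all_order all_algebra.
From mathcomp Require Import all_classical all_reals all_analysis.

Set Implicit Arguments.
Unset Strict Implicit.
Unset Printing Implicit Defensive.

Import Order.TTheory GRing.Theory Num.Theory.
Import numFieldNormedType.Exports.

Local Open Scope classical_set_scope.
Local Open Scope ring_scope.

(* Z as a subgroup of R: [Num.int_num_subdef] is the predicate underlying
   [Num.int]. *)
Definition integers (R : realType) : zmodClosed R :=
  GRing.ZmodClosed.clone R (@Num.int_num_subdef R) _.

(* The quotient group R / Z, with the quotient topology. *)
Definition circle (R : realType) : Type :=
  quotient_topology (Quotient.quot (integers R)).

HB.instance Definition _ (R : realType) := Topological.on (circle R).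
HB.instance Definition _ (R : realType) := Pointed.on (circle R).
HB.instance Definition _ (R : realType) := Quotient.on (circle R).
HB.instance Definition _ (R : realType) :=
  GRing.isZmodule.Build (circle R) (@Quotient.addqA R (integers R))
    (@Quotient.addqC R (integers R)) (@Quotient.add0q R (integers R))
    (@Quotient.addNq R (integers R)).

(* The product group, with the product topology. *)
Definition torus2 (R : realType) : Type := (circle R * circle R)%type.

HB.instance Definition _ (R : realType) := Topological.on (torus2 R).
HB.instance Definition _ (R : realType) := Pointed.on (torus2 R).
HB.instance Definition _ (R : realType) := GRing.Zmodule.on (torus2 R).

Definition borel (T : ptopologicalType) := g_sigma_algebraType (@open T).

Definition homeomorphism (T U : topologicalType) (f : T -> U) : Prop :=
  continuous f /\
  exists g : U -> T, [/\ continuous g, cancel f g & cancel g f].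

(* Together with the total mass 1 built into [probability], this characterises
   the (normalised) Haar measure of the compact group torus2 R. *)
Definition is_haar (R : realType) (mu : probability (borel (torus2 R)) R) :
  Prop :=
  forall (z : torus2 R) (B : set (borel (torus2 R))), measurable B ->
    mu [set z + w | w in (B : set (torus2 R))] = mu B.

Definition preserves_measure d (T : measurableType d) (R : realType)
    (mu : {measure set T -> \bar R}) (f : T -> T) : Prop :=
  forall B : set T, measurable B -> mu (f @^-1` B) = mu B.

(* Main.v *)
Require Import Defs.
From HB Require Import structures.
From mathcomp Require Import all_boot all_order all_algebra.
From mathcomp Require Import lra.
From mathcomp Require Import all_classical all_reals all_analysis.

Set Implicit Arguments.
Unset Strict Implicit.
Unset Printing Implicit Defensive.

Import Order.TTheory GRing.Theory Num.Theory.
Import numFieldNormedType.Exports.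

Local Open Scope classical_set_scope.
Local Open Scope ring_scope.

(** In the coordinates [(u, y)] with [u = x + g1 y] the map becomes
    [(u, y) |-> (u, H u y)] with [H u y = h (u - g1 y, y)]: it acts on each
    vertical fibre separately. Disintegrating the invariant measure over [u],
    almost every [H u], hence by continuity every [H u], is a length-preserving
    homeomorphism of the circle, that is a rotation or a reflection. The sign
    is continuous in [u], hence constant because the circle is connected, and
    [g2 u = H u 0].

    The proof below replaces disintegration by a finite slicing. A set invariant
    under horizontal translation is cut by [x + g1 y] lying in an arc of length
    [1 / n] into [n] translates of one piece ([measure_slices]). Thin slices let
    a compactness argument read off, from invariance of the measure, that no
    [H u] maps an arc onto a set containing a longer arc ([shear_arc_le]), since
    a strip over a longer arc has strictly larger measure ([measure_strip_lt]).
    This half of length preservation suffices: applied to the two complementary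
    arcs between [y] and [y + t], whose images are connected and overlap only at
    their ends, it gives [H u (y + t) = H u y + t] or [H u (y + t) = H u y - t]
    ([expansionless_circle_map], by [connected_contains_arc]). Additive algebra
    makes the sign independent of [y] and [t] ([pointwise_pm_uniform]). *)

(** * The projection of the line onto the circle *)

Definition cproj (R : realType) (t : R) : circle R := \pi_(circle R)%qT t.

Lemma cprojD (R : realType) (s t : R) : cproj (s + t) = cproj s + cproj t.
Proof. exact: (Quotient.pi_add (integers R)). Qed.

Lemma cprojN (R : realType) (t : R) : cproj (- t) = - cproj t.
Proof. exact: (Quotient.pi_opp (integers R)). Qed.

Lemma cprojB (R : realType) (s t : R) : cproj (s - t) = cproj s - cproj t.
Proof. by rewrite cprojD cprojN. Qed.

Lemma int_integersE (R : realType) (t : R) : (t \is a Num.int) = (t \in integers R).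
Proof. reflexivity. Qed.

Lemma cproj_eqP (R : realType) (s t : R) :
  cproj s = cproj t <-> exists k : int, s = t + k%:~R.
Proof.
have E : (s - t \is a Num.int) <-> cproj s = cproj t.
  rewrite int_integersE Quotient.idealrBE; split=> [/eqP st|st]; [exact: st|].
  by apply/eqP; exact: st.
split.
  by move=> /E /intrP [k Hk]; exists k; rewrite -Hk addrC subrK.
move=> [k st]; apply/E/intrP; exists k.
by rewrite st addrC addKr.
Qed.

Lemma cproj1 (R : realType) : cproj (1 : R) = 0.
Proof.
have -> : (0 : circle R) = cproj 0 by rewrite -(subrr (cproj (0 : R))) -cprojB subrr.
by apply/cproj_eqP; exists 1; rewrite add0r.
Qed.

Lemma cprojD1 (R : realType) (t : R) : cproj (t + 1) = cproj t.
Proof. by rewrite cprojD cproj1 addr0. Qed.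

Lemma cproj_inj (R : realType) (s t : R) : `|s - t| < 1 -> cproj s = cproj t -> s = t.
Proof.
move=> st /cproj_eqP[k E]; move: st; rewrite E addrC addKr => st.
have -> : k = 0 by apply/eqP; rewrite -absz_eq0; move: st;
  rewrite -intr_norm -[1]/(1%:~R) ltr_int -abszE; case: (absz k).
by rewrite addr0.
Qed.

(** Every half-open interval of length one is a fundamental domain; choosing
    the origin [a] well turns identities between arcs into linear inequalities
    between representatives. *)
Lemma cproj_repr (R : realType) (a : R) (z : circle R) :
  exists2 t, a <= t < a + 1 & cproj t = z.
Proof.
pose s : R := repr z; have sE : cproj s = z by exact: reprK.
exists (s - (Num.floor (s - a))%:~R).
  have := Num.Theory.floor_itv (s - a); rewrite intrD => /andP[].
  by move=> *; apply/andP; split; lra.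
by rewrite -sE; apply/cproj_eqP; exists (- Num.floor (s - a)); rewrite mulrNz.
Qed.

Lemma cproj_continuous (R : realType) : continuous (@cproj R).
Proof. exact: pi_continuous. Qed.

(** The saturation of [U] is the union of its integer translates. *)
Lemma cproj_open (R : realType) (U : set R) : open U -> open (@cproj R @` U).
Proof.
move=> oU; suff : open [set t : R | (@cproj R @` U) (cproj t)] by [].
have -> : [set t : R | (@cproj R @` U) (cproj t)] =
    \bigcup_(k : int) [set t | U (t + k%:~R)].
  rewrite predeqE => t; split => [[s Us /cproj_eqP[k Hk]]|[k _ Uk]].
    by exists k => //=; rewrite -Hk.
  by exists (t + k%:~R) => //; apply/cproj_eqP; exists k.
apply: bigcup_open => k _.
by apply: open_comp => // t _; apply: cvgD; [exact: cvg_id|exact: cvg_cst].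
Qed.

Lemma circle_continuous (R : realType) (T : topologicalType) (c : circle R -> T) :
  continuous (c \o @cproj R) -> continuous c.
Proof. by move=> cc; apply/quotient_continuous. Qed.

Lemma circle_addl_continuous (R : realType) (u : circle R) : continuous (fun z => u + z).
Proof.
have [s _ <-] := cproj_repr 0 u; apply: circle_continuous.
rewrite (_ : _ \o _ = @cproj R \o (fun t => s + t)); last first.
  by apply/funext => t /=; rewrite cprojD.
move=> t; apply: continuous_comp; last exact: cproj_continuous.
by apply: cvgD; [exact: cvg_cst|exact: cvg_id].
Qed.

Lemma circle_addr_continuous (R : realType) (u : circle R) : continuous (fun z => z + u).
Proof.
rewrite (_ : (fun z => z + u) = (fun z => u + z)); first exact: circle_addl_continuous.
by apply/funext => z; rewrite addrC.
Qed.

Lemma circle_opp_continuous (R : realType) : continuous (fun z : circle R => - z).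
Proof.
apply: circle_continuous.
rewrite (_ : _ \o _ = @cproj R \o (fun t => - t)); last first.
  by apply/funext => t /=; rewrite cprojN.
move=> t; apply: continuous_comp; last exact: cproj_continuous.
by apply: cvgN; exact: cvg_id.
Qed.

Lemma circle_connected (R : realType) : connected [set: circle R].
Proof.
have -> : [set: circle R] = @cproj R @` `[0, 1].
  rewrite predeqE => z; split=> // _.
  have [t /andP[t0 t1] <-] := cproj_repr 0 z; exists t => //=.
  by rewrite in_itv /= t0 -[1]add0r ltW.
apply: connected_continuous_connected; first exact: segment_connected.
by apply: continuous_subspaceT; exact: cproj_continuous.
Qed.

(** * Arcs *)

Lemma cproj_segment_compact (R : realType) (a b : R) : compact (@cproj R @` `[a, b]).
Proof.
apply: continuous_compact; last exact: segment_compact.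
by apply: continuous_subspaceT; exact: cproj_continuous.
Qed.

Lemma cproj_itv_open (R : realType) (a b : R) : open (@cproj R @` `]a, b[).
Proof. by apply: cproj_open; exact: itv_open. Qed.

(** Presents a closed arc as the complement of an open one, which makes it
    closed. *)
Lemma setC_open_arc (R : realType) (a b : R) : a <= b <= a + 1 ->
  ~` (@cproj R @` `]b, a + 1[) = @cproj R @` `[a, b].
Proof.
move=> ab; rewrite predeqE => z; split.
  have [t ta <-] := cproj_repr a z => nt; exists t => //=; rewrite in_itv /=.
  case: (leP t b) => tb; first lra.
  by exfalso; apply: nt; exists t => //=; rewrite in_itv /=; lra.
move=> [t /= + <-] [s /= + /esym st]; rewrite !in_itv /= => ta sa.
by have := cproj_inj _ st; rewrite ltr_norml => /(_ ltac:(lra)); lra.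
Qed.

(** Presents a half-open arc as a difference of open ones, which makes it
    Borel. The left end [t + d - 1] is the furthest that keeps the larger arc
    injectively parametrised. *)
Lemma half_open_arcE (R : realType) (t d : R) : 0 < d < 1 ->
  @cproj R @` `[t, t + d[ =
  @cproj R @` `]t + d - 1, t + d[ `\` @cproj R @` `]t + d - 1, t[.
Proof.
move=> d01; rewrite predeqE => z; split.
  move=> [s /= + <-]; rewrite in_itv /= => sd; split.
    by exists s => //=; rewrite in_itv /=; lra.
  move=> [r /= + rs]; rewrite in_itv /= => rd.
  by have := cproj_inj _ rs; rewrite ltr_norml => /(_ ltac:(lra)); lra.
move=> [[s /= + <-] ns]; rewrite in_itv /= => sd.
exists s => //=; rewrite in_itv /=.
case: (leP t s) => ts; first lra.
by exfalso; apply: ns; exists s => //=; rewrite in_itv /=; lra.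
Qed.

Lemma circle_hausdorff (R : realType) : hausdorff_space (circle R).
Proof.
rewrite open_hausdorff => p q.
have [s _ <-] := cproj_repr 0 p; have [t ts <-] := cproj_repr s q => /eqP st.
have {}ts : s < t < s + 1.
  by move: ts; rewrite le_eqVlt => /andP[/orP[/eqP e|->->]//]; rewrite e in st.
pose e := Num.min ((t - s) / 2) ((s + 1 - t) / 2).
have [e1 e2 e0] : [/\ e <= (t - s) / 2, e <= (s + 1 - t) / 2 & 0 < e].
  by rewrite /e !ge_min !lexx orbT /= lt_min; split=> //; lra.
exists (@cproj R @` `]s - e, s + e[, @cproj R @` `]t - e, t + e[) => /=.
  by rewrite !inE; split; [exists s|exists t] => //=; rewrite in_itv /=; lra.
split; [exact: cproj_itv_open|exact: cproj_itv_open|apply/eqP].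
rewrite -subset0 => z [[x /= + <-] [y /= + yx]]; rewrite !in_itv /= => xs yt.
by have := cproj_inj _ yx; rewrite ltr_norml => /(_ ltac:(lra)); lra.
Qed.

Lemma connected_open_cover (T : topologicalType) (E U V : set T) :
  connected E -> open U -> open V -> U `&` V = set0 -> E `<=` U `|` V ->
  E `&` U !=set0 -> E `<=` U.
Proof.
move=> cE oU oV UV EUV EU.
suff <- : E `&` U = E by exact: subIsetr.
apply: cE => //; first by exists U.
exists (~` V); first by rewrite closedC.
rewrite predeqE => x; split=> -[Ex]; first move=> Ux.
  by split=> // Vx; rewrite -[False]/(@set0 T x) -UV.
by move=> nV; split=> //; have [] := EUV _ Ex.
Qed.

(** Removing a point from each of the two arcs that join [cproj s] to
    [cproj t] separates these endpoints, so a connected set containing both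
    cannot miss a point of each arc. *)
Lemma connected_contains_arc (R : realType) (E : set (circle R)) (s t : R) :
  s < t < s + 1 -> connected E -> E (cproj s) -> E (cproj t) ->
  @cproj R @` `[s, t] `<=` E \/ @cproj R @` `[t, s + 1] `<=` E.
Proof.
move=> st cE Es Et; apply: contrapT => /not_orP[].
move=> /nonsubset[_ [[r /= + <-] nr]] /nonsubset[_ [[r' /= + <-] nr']].
rewrite !in_itv /= => rst rts.
have neq u v : E (cproj u) -> ~ E (cproj v) -> v != u.
  by move=> Eu nv; apply/eqP => uv; apply: nv; rewrite uv.
have rs := neq _ _ Es nr; have rt := neq _ _ Et nr; have rt' := neq _ _ Et nr'.
have rs' : r' != s + 1 by apply: (neq _ _ _ nr'); rewrite cprojD1.
have {}rst : s < r < t by rewrite !lt_neqAle rt eq_sym rs; lra.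
have {}rts : t < r' < s + 1 by rewrite !lt_neqAle rs' (eq_sym t) rt'; lra.
(* The missed points r and r' cut the circle into two open arcs; E lies in the
   one through t, although the other contains s + 1. *)
have EU : E `<=` @cproj R @` `]r, r'[.
  apply: (@connected_open_cover _ _ _ (@cproj R @` `]r', r + 1[)) => //.
  - exact: cproj_itv_open.
  - exact: cproj_itv_open.
  - rewrite -subset0 => z [[x /= + <-] [y /= + yx]]; rewrite !in_itv /= => xr yr.
    by have := cproj_inj _ yx; rewrite ltr_norml => /(_ ltac:(lra)); lra.
  - move=> z Ez; have [x xr xz] := cproj_repr r z.
    have xr1 : x != r by rewrite eq_sym (neq _ _ _ nr)// xz.
    have xr2 : x != r' by rewrite eq_sym (neq _ _ _ nr')// xz.
    by case: (ltgtP x r') xr2 => // xr' _; [left|right]; exists x => //=;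
      rewrite in_itv /=; move: xr xr1; case: ltgtP => //; lra.
  - by exists (cproj t); split=> //; exists t => //=; rewrite in_itv /=; lra.
have [x /= + xs] := EU _ Es; rewrite in_itv /= => xr.
have := @cproj_inj R x (s + 1); rewrite cprojD1 => /(_ _ xs).
by rewrite ltr_norml => /(_ ltac:(lra)); lra.
Qed.

(** * Haar measure of strips *)

Lemma open_borel (T : ptopologicalType) (U : set T) :
  open U -> measurable (U : set (borel T)).
Proof. by move=> oU; apply: sub_sigma_algebra. Qed.

Lemma open_preimage_borel (T : ptopologicalType) (Z : topologicalType) (c : T -> Z)
    (U : set Z) : continuous c -> open U -> measurable (c @^-1` U : set (borel T)).
Proof. by move=> cc oU; apply: open_borel; move/continuousP: cc; apply. Qed.

Lemma continuous_preimage_borel (T Z : ptopologicalType) (c : T -> Z)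
    (S : set (borel Z)) : continuous c -> measurable S ->
  measurable (c @^-1` S : set (borel T)).
Proof.
move=> cc mS.
have mc : measurable_fun setT (c : borel T -> borel Z).
  apply: (@measurability _ _ (borel T) (borel Z) setT c (@open Z) erefl) => _ [U oU <-].
  by rewrite setTI; exact: open_preimage_borel.
by rewrite -[X in measurable X]setTI; exact: mc.
Qed.

Lemma half_open_arc_preimage_borel (R : realType) (T : ptopologicalType)
    (c : T -> circle R) (t d : R) : continuous c -> 0 < d < 1 ->
  measurable (c @^-1` (@cproj R @` `[t, t + d[) : set (borel T)).
Proof.
move=> cc d01; rewrite half_open_arcE //.
set U := _ @` `]_, t + d[; set V := _ @` `]_, t[.
have -> : c @^-1` (U `\` V) = (c @^-1` U) `\` (c @^-1` V) by [].
by apply: measurableD; apply: open_preimage_borel => //; exact: cproj_itv_open.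
Qed.

(** The circle is the disjoint union of [n.+2] rotated copies of the half-open
    arc starting at [t], and translation by [e] permutes the corresponding
    pieces of [S]; by invariance they all have the same measure. The cut is made
    along an arbitrary [c] equivariant under [e], which covers both the vertical
    slices of the torus and their images under a shear. At least two slices are
    taken because the arc has to be a proper part of the circle. *)
Lemma measure_slices (R : realType) (mu : probability (borel (torus2 R)) R)
    (n : nat) (t : R) (c : torus2 R -> circle R) (e : torus2 R)
    (S : set (borel (torus2 R))) :
  is_haar mu -> continuous c ->
  (forall z, c (e + z) = cproj n.+2%:R^-1 + c z) ->
  measurable S -> (forall z, S (e + z) <-> S z) ->
  mu S = (\sum_(k < n.+2)
    mu (S `&` c @^-1` (@cproj R @` `[t, (t + n.+2%:R^-1)%R[)))%E.
Proof.
move=> haar cc ce mS Se; set x : R := n.+2%:R^-1.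
have x0 : 0 < x by rewrite invr_gt0.
have xn : n.+2%:R * x = 1 by rewrite divff // pnatr_eq0.
have x1 : x < 1 by rewrite invf_lt1 // ltr1n.
pose F k := S `&` c @^-1` (@cproj R @` `[t + k%:R * x, t + k%:R * x + x[).
have mF k : measurable (F k).
  by apply: measurableI => //; apply: half_open_arc_preimage_borel => //; rewrite x0.
(* Translating by e k times rotates the value of c by k / (n + 2). *)
have cek k z : c (e *+ k + z) = cproj (k%:R * x) + c z.
  elim: k => [|k IH].
    by rewrite mulr0n add0r mul0r -[LHS]add0r -(subrr (cproj 0)) -cprojB subr0.
  by rewrite mulrS -addrA ce IH addrA -cprojD -/x mulrSr mulrDl mul1r [x + _]addrC.
have Sek k z : S (e *+ k + z) <-> S z.
  by elim: k => [|k IH]; [rewrite mulr0n add0r|rewrite mulrS -addrA Se].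
have muF k : mu (F k) = mu (S `&` c @^-1` (@cproj R @` `[t, t + x[)).
  have mF0 : measurable (S `&` c @^-1` (@cproj R @` `[t, t + x[)).
    by have := mF 0%N; rewrite /F mul0r addr0.
  rewrite -(haar (e *+ k) _ mF0); congr (mu _); rewrite predeqE => z; split.
    move=> [Sz [s /= + sz]]; rewrite in_itv /= => ts.
    exists (- (e *+ k) + z); last by rewrite addNKr.
    split; first by apply/(Sek k); rewrite addNKr.
    exists (s - k%:R * x); first by rewrite /= in_itv /=; lra.
    have := cek k (- (e *+ k) + z); rewrite addNKr -sz => E.
    by rewrite cprojB E addrC addKr.
  move=> [w [Sw [s /= + sw]] <-]; rewrite in_itv /= => ts.
  split; first by apply/Sek.
  exists (k%:R * x + s); first by rewrite /= in_itv /=; lra.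
  by rewrite cek -sw cprojD.
have SE : S = \bigcup_(k in `I_n.+2) F k.
  rewrite predeqE => z; split=> [Sz|[k _ []]//].
  have [s ts sz] := cproj_repr t (c z).
  have y0 : 0 <= (s - t) * n.+2%:R by rewrite mulr_ge0 // subr_ge0; case/andP: ts.
  have := Num.Theory.truncn_itv y0; set k := Num.truncn _ => /andP[k1 k2].
  have yx : (s - t) * n.+2%:R * x = s - t by rewrite -mulrA xn mulr1.
  exists k.
    rewrite /= -(@ltr_nat R) (le_lt_trans k1) // gtr_pMl //; lra.
  split=> //; exists s => //=; rewrite in_itv /=.
  move: k1 k2; rewrite -(ler_pM2r x0) -(ltr_pM2r x0) yx mulrSr mulrDl mul1r; lra.
rewrite {1}SE measure_fin_bigcup //; first
  by rewrite -fsbig_ord; apply: eq_bigr => k _; exact: muF.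
move=> i j /= iN jN [z [[_ [s /= + sz]] [_ [r /= + rz]]]].
rewrite !in_itv /= => si rj.
(* All slices have representatives in [t, t + 1), where the projection is
   injective. *)
have le1 k : (k < n.+2)%N -> k%:R * x + x <= 1.
  move=> kN; rewrite -[leRHS]xn -[X in _ + X]mul1r -mulrDl ler_pM2r //.
  by rewrite -mulrSr ler_nat.
have := le1 _ iN; have := le1 _ jN => lj li.
have ge0 k : 0 <= k%:R * x by rewrite mulr_ge0 // ltW.
have sr : s = r.
  by apply: cproj_inj; [rewrite ltr_norml; have := ge0 i; have := ge0 j; lra|rewrite sz].
have lt k l : k%:R * x < l%:R * x + x -> (k <= l)%N.
  by rewrite -[X in _ + X]mul1r -mulrDl ltr_pM2r // -mulrSr ltr_nat.
by apply/eqP; rewrite eqn_leq !lt //; lra.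
Qed.

Lemma exists_inv_lt (R : realType) (e : R) : 0 < e -> exists n : nat, n.+2%:R^-1 < e.
Proof.
move=> e0; exists (Num.truncn e^-1).
rewrite -[ltRHS]invrK ltf_pV2 ?posrE ?invr_gt0 //.
have ie0 : 0 <= e^-1 by rewrite invr_ge0 ltW.
have /andP[_ /lt_trans] := Num.Theory.truncn_itv ie0; apply.
by rewrite ltr_nat.
Qed.

(** Finitely many translates of an open strip cover the torus, so a null strip
    would make the whole torus null. *)
Lemma measure_horizontal_strip_gt0 (R : realType) (mu : probability (borel (torus2 R)) R)
    (a b : R) : is_haar mu -> a < b ->
  (0 < mu (setT `*` (@cproj R @` `]a, b[) : set (borel (torus2 R))))%E.
Proof.
move=> haar ab.
have [n nab] : exists n : nat, n.+2%:R^-1 < b - a by apply: exists_inv_lt; lra.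
have [t [ta tb]] : exists t, a < t /\ t + n.+2%:R^-1 < b.
  by exists ((a + (b - n.+2%:R^-1)) / 2); move: (n.+2%:R^-1) nab => x xb; split; lra.
have := @measure_slices R mu n t snd (0, cproj n.+2%:R^-1) setT haar.
move=> /(_ (fun z => cvg_snd) (fun _ => erefl) measurableT (fun _ => iff_refl _)).
rewrite setTI => mu1.
rewrite lt0e measure_ge0 andbT; apply/eqP => mu0.
have : mu setT = 0%E.
  rewrite mu1 big1 // => i _; apply/eqP; rewrite eq_le measure_ge0 andbT -mu0.
  apply: le_measure; rewrite ?inE.
  - by apply: half_open_arc_preimage_borel;
      [move=> z; exact: cvg_snd|rewrite invr_gt0 invf_lt1 // ltr1n ltr0n].
  - rewrite setTX; apply: open_preimage_borel; [move=> z; exact: cvg_snd|].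
    exact: cproj_itv_open.
  - move=> z [s /= + sz]; rewrite in_itv /= => st; split=> //; exists s => //=.
    by case/andP: st => ts st; rewrite /= in_itv /= (lt_le_trans ta ts) (lt_trans st).
by rewrite probability_setT => -[] /eqP; rewrite oner_eq0.
Qed.

Lemma closed_arc (R : realType) (a b : R) : a <= b <= a + 1 ->
  closed (@cproj R @` `[a, b]).
Proof.
by move=> ab; rewrite -setC_open_arc // closedC; exact: cproj_itv_open.
Qed.

Lemma strip_open_borel (R : realType) (U : set (circle R)) : open U ->
  measurable (setT `*` U : set (borel (torus2 R))).
Proof.
move=> oU; have -> : setT `*` U = snd @^-1` U :> set (torus2 R).
  by rewrite predeqE => z; split => // -[].
by apply: open_preimage_borel => // z; exact: cvg_snd.
Qed.

Lemma strip_closed_borel (R : realType) (B : set (circle R)) : closed B ->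
  measurable (setT `*` B : set (borel (torus2 R))).
Proof.
move=> cB; rewrite -[X in measurable X]setCK; apply: measurableC.
have -> : ~` (setT `*` B) = setT `*` ~` B :> set (torus2 R).
  rewrite predeqE => z; split=> [nz|[_ nB] [_ //]].
  by split=> // Bz; apply: nz.
by apply: strip_open_borel; rewrite openC.
Qed.

(** Rotate the closed arc so that it starts at [a]: it then contains the open
    one together with a disjoint open arc, whose strip has positive measure. *)
Lemma measure_strip_lt (R : realType) (mu : probability (borel (torus2 R)) R)
    (a b s l : R) : is_haar mu -> 0 <= l < 1 -> a < b -> b - a < l ->
  (mu (setT `*` (@cproj R @` `]a, b[) : set (borel (torus2 R))) <
   mu (setT `*` (@cproj R @` `[s, (s + l)%R]) : set (borel (torus2 R))))%E.
Proof.
move=> haar l01 ab bl.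
have mC x : measurable (setT `*` (@cproj R @` `[x, x + l]) : set (borel (torus2 R))).
  by apply: strip_closed_borel; apply: closed_arc; lra.
have mO x y : measurable (setT `*` (@cproj R @` `]x, y[) : set (borel (torus2 R))).
  by apply: strip_open_borel; exact: cproj_itv_open.
have -> : mu (setT `*` (@cproj R @` `[s, s + l])) = mu (setT `*` (@cproj R @` `[a, a + l])).
  rewrite -(haar (0, cproj (s - a)) _ (mC a)); congr (mu _).
  rewrite predeqE => -[z1 z2]; split=> /=.
    move=> [_ [r /= + rz]]; rewrite in_itv /= => rs.
    exists (z1, cproj (r - (s - a))).
      by split=> //; exists (r - (s - a)) => //=; rewrite in_itv /=; lra.
    congr pair; first by rewrite add0r.
    by rewrite -[X in X = _]/(cproj (s - a) + cproj (r - (s - a))) -cprojD addrC subrK.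
  move=> [[w1 w2] [_ [r /= + <-]] [_ <-]]; rewrite in_itv /= => ra.
  by split=> //; exists (s - a + r); [rewrite /= in_itv /=; lra|rewrite cprojD].
set X := setT `*` (_ @` `]a, b[); set Z := setT `*` _.
pose Y : set (borel (torus2 R)) := setT `*` (@cproj R @` `]b, a + l[).
have Y0 : (0 < mu Y)%E by apply: measure_horizontal_strip_gt0 => //; lra.
have XY : (mu X + mu Y <= mu Z)%E.
  rewrite -measureU.
  - apply: le_measure; rewrite ?inE; [by apply: measurableU; exact: mO|exact: mC|].
    by move=> z [] [_ [r /= + rz]]; rewrite in_itv /= => rab; split=> //; exists r => //=;
      rewrite in_itv /=; lra.
  - exact: mO.
  - exact: mO.
  - rewrite -subset0 => z [[_ [r /= + rz]] [_ [r' /= + rz']]].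
    rewrite !in_itv /= => rab rb.
    by have := @cproj_inj R r r'; rewrite rz rz' ltr_norml => /(_ ltac:(lra) erefl); lra.
by apply: lt_le_trans XY; rewrite lteDl // fin_num_measure //; exact: mO.
Qed.

(** This is where invariance of the measure enters. With [H u] the map that
    [f] induces on the fibre over [u], whose inverse is [fun z => (g (u, z)).2]
    when [g] inverts [f], the hypothesis says that the arc [B] of length [l'] is
    inside the image under [H u] of an arc of length [l]. If
    [l < l'], enlarge the latter arc to an open arc [K] still shorter than [B].
    By compactness of [B], [H v] pulls [B] back into [K] for all [v] in a small
    arc [A] around [u]. Hence the preimage of [A `*` B] under [f] lies in the
    part of the strip over [K] where [(f z).1] is in [A]. As
    [A `*` B] is one of [n.+2] equal slices of the strip over [B], and that part
    one of [n.+2] equal slices of the strip over [K], the strip over [B] is at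
    most as large as the strip over [K], contrary to their lengths. *)
Lemma shear_arc_le (R : realType) (mu : probability (borel (torus2 R)) R)
    (g1 : circle R -> circle R) (f g : torus2 R -> torus2 R)
    (u : circle R) (a l s l' : R) :
  is_haar mu -> preserves_measure mu f -> continuous f -> continuous g ->
  cancel f g -> (forall z, (f z).1 = z.1 + g1 z.2) ->
  0 <= l -> 0 <= l' < 1 ->
  (forall z, (@cproj R @` `[s, s + l']) z ->
             (@cproj R @` `[a, a + l]) (g (u, z)).2) ->
  l' <= l.
Proof.
move=> haar fmu cf cg fK f1 l0 l01 BC; rewrite leNgt; apply/negP => ll.
(* With this margin K has length (l + l') / 2, strictly between l and l'. *)
pose e := (l' - l) / 4; have e0 : 0 < e by rewrite /e; lra.
set B := _ @` `[s, _] in BC.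
pose K := @cproj R @` `]a - e, a + l + e[.
have oK : open K by exact: cproj_itv_open.
have cB : closed B by apply: closed_arc; lra.
have near_u : \forall u' \near u, B `<=` (fun z => K (g (u', z)).2).
  have /compact_near_coveringP nearB := @cproj_segment_compact R s (s + l').
  apply: (nearB _ (nbhs u) (fun v z => K (g (v, z)).2)) => z Bz.
  have Kz : K (g (u, z)).2.
    have [r /= + rz] := BC _ Bz; rewrite in_itv /= => ra.
    by exists r => //=; rewrite in_itv /=; lra.
  have : nbhs (u, z) (fun w => K (g w).2).
    apply: (cg (u, z) [set w | K w.2]); exists (setT, K) => /=.
      by split; [exact: filterT|exact: open_nbhs_nbhs].
    by move=> w [].
  case=> -[U V] /= [Uu Vz] UV.
  by exists (V, U) => //= -[v w] /= [Vv Uw]; apply: (UV (w, v)).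
have [t _ tu] := cproj_repr 0 u.
have : \forall t' \near t, B `<=` (fun z => K (g (cproj t', z)).2).
  by rewrite -tu in near_u; exact: (cproj_continuous near_u).
move=> /nbhs_ballP[d /= d0 dB].
have [n nd] := exists_inv_lt d0.
have x0 : 0 < n.+2%:R^-1 :> R by rewrite invr_gt0.
have x1 : n.+2%:R^-1 < 1 :> R by rewrite invf_lt1 // ltr1n.
pose A := @cproj R @` `[t, t + n.+2%:R^-1[.
have AB v z : A v -> B z -> K (g (v, z)).2.
  move=> [r /= + <-] Bz; rewrite in_itv /= => /andP[tr rt]; apply: dB => //.
  by rewrite /ball /= distrC ger0_norm ?subr_ge0 // ltrBlDl (lt_trans rt) // ltrD2l.
have : (mu (setT `*` B : set (borel (torus2 R))) <=
        mu (setT `*` K : set (borel (torus2 R))))%E.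
  (* Horizontal translation by ex permutes the slices of both strips, the
     sheared ones included, since f adds to x a function of y alone. *)
  pose ex : torus2 R := (cproj n.+2%:R^-1, 0).
  have c1 : continuous (fst : torus2 R -> circle R) by move=> z; exact: cvg_fst.
  have c2 : continuous (fst \o f) by move=> z; apply: continuous_comp; [exact: cf|exact: c1].
  have e1 z : (ex + z).1 = cproj n.+2%:R^-1 + z.1 by [].
  have e2 z : (fst \o f) (ex + z) = cproj n.+2%:R^-1 + (fst \o f) z.
    by rewrite /= !f1 /= add0r addrA.
  have inv X z : (setT `*` X) (ex + z) <-> (setT `*` X) z by rewrite /= add0r.
  rewrite (measure_slices t haar c1 e1 (strip_closed_borel cB) (inv B)).
  rewrite (measure_slices t haar c2 e2 (strip_open_borel oK) (inv K)).
  apply: lee_sum => i _.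
  rewrite -fmu; last first.
    apply: measurableI; first exact: strip_closed_borel.
    by apply: half_open_arc_preimage_borel; [exact: c1|rewrite x0].
  apply: le_measure; rewrite ?inE.
  - apply: continuous_preimage_borel => //; apply: measurableI.
      exact: strip_closed_borel.
    by apply: half_open_arc_preimage_borel; [exact: c1|rewrite x0].
  - apply: measurableI; first exact: strip_open_borel.
    by apply: half_open_arc_preimage_borel; [exact: c2|rewrite x0].
  move=> z [[_ Bz] Az]; split=> //; split=> //.
  by have := AB _ _ Az Bz; rewrite -surjective_pairing fK.
rewrite leNgt => /negP; apply; apply: measure_strip_lt => //; rewrite /e; lra.
Qed.

(** * Rigidity of the fibre maps *)

(** The points [x] and [x + t] cut the circle into arcs of lengths [l] and
    [1 - l]. By connectedness the image of each contains one of the two arcs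
    between [K x] and [K (x + t)], and by injectivity not the same one. As
    neither image contains a longer arc, the arcs between [K x] and [K (x + t)]
    have lengths [l] and [1 - l] in one order or the other. *)
Lemma expansionless_circle_map (R : realType) (K : circle R -> circle R) :
  continuous K -> injective K ->
  (forall a l s l' : R, 0 <= l -> 0 <= l' < 1 ->
    @cproj R @` `[s, s + l'] `<=` K @` (@cproj R @` `[a, a + l]) -> l' <= l) ->
  forall x t, K (x + t) = K x + t \/ K (x + t) = K x - t.
Proof.
move=> cK iK arcK x t.
have [a _ <-] := cproj_repr 0 x; have [l l01 <-] := cproj_repr 0 t.
have [->|l0] := eqVneq l 0.
  have -> : cproj (0 : R) = 0 by rewrite -(subrr 0) cprojB subrr.
  by left; rewrite !addr0.
have {l01 l0} l01 : 0 < l < 1 by rewrite lt_neqAle eq_sym l0; lra.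
have [s _ sE] := cproj_repr 0 (K (cproj a)).
have [r rs rE] := cproj_repr s (K (cproj a + cproj l)).
have a_l : cproj (a + l) != cproj a.
  apply/eqP => /cproj_inj; rewrite ltr_norml => /(_ ltac:(lra)); lra.
have {}rs : s < r < s + 1.
  rewrite lt_neqAle; move: rs => /andP[-> ->]; rewrite !andbT; apply/eqP => sr.
  by move/eqP: a_l; apply; apply: iK; rewrite cprojD -rE -sE sr.
pose E1 := K @` (@cproj R @` `[a, a + l]).
pose E2 := K @` (@cproj R @` `[a + l, a + 1]).
have cE u v : connected (K @` (@cproj R @` `[u, v])).
  apply: connected_continuous_connected; last exact: continuous_subspaceT.
  apply: connected_continuous_connected; first exact: segment_connected.
  by apply: continuous_subspaceT; exact: cproj_continuous.
have mem u v w : u <= w <= v -> (K @` (@cproj R @` `[u, v])) (K (cproj w)).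
  by move=> uwv; exists (cproj w) => //; exists w => //=; rewrite in_itv.
have E1s : E1 (cproj s) by rewrite sE; apply: mem; lra.
have E1r : E1 (cproj r) by rewrite rE -cprojD; apply: mem; lra.
have E2s : E2 (cproj s) by rewrite sE -(cprojD1 a); apply: mem; lra.
have E2r : E2 (cproj r) by rewrite rE -cprojD; apply: mem; lra.
(* Injectivity of K: the two images share only the end points. *)
have E12 z : E1 z -> E2 z -> z = cproj s \/ z = cproj r.
  move=> [_ [b /= + <-] <-] [_ [c /= + <-] /iK bc]; rewrite !in_itv /= => ba ca.
  have [ba1|ba1] := eqVneq b a; first by left; rewrite sE ba1.
  have {}ba1 : a < b by rewrite lt_neqAle eq_sym ba1; lra.
  right; rewrite rE -cprojD; congr (K (cproj _)).
  by have := @cproj_inj R c b; rewrite ltr_norml => /(_ ltac:(lra) bc); lra.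
(* Neither arc between the images can lie in both E1 and E2: its midpoint would
   be an end point. *)
have mid u v : (u = s /\ v = r) \/ (u = r /\ v = s + 1) ->
    @cproj R @` `[u, v] `<=` E1 -> @cproj R @` `[u, v] `<=` E2 -> False.
  move=> uv uE1 uE2; pose m := (u + v) / 2.
  have um : (@cproj R @` `[u, v]) (cproj m).
    by exists m => //=; rewrite in_itv /= /m; case: uv => -[-> ->]; lra.
  have [/cproj_inj|/cproj_inj] := E12 _ (uE1 _ um) (uE2 _ um);
    by rewrite ltr_norml /m; case: uv => -[-> ->] /(_ ltac:(lra)); lra.
have r1 : r = s + (r - s) by rewrite addrC subrK.
have r2 : s + 1 = r + (s + 1 - r) by rewrite [RHS]addrC subrK.
have a2 : a + 1 = a + l + (1 - l) by rewrite -addrA [l + _]addrC subrK.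
have rs1 : 0 <= r - s < 1 by lra.
have rs2 : 0 <= s + 1 - r < 1 by lra.
have l1 : 0 <= 1 - l by lra.
have l2 : 0 <= l by lra.
have [A1|A1] := connected_contains_arc rs (cE _ _) E1s E1r;
have [A2|A2] := connected_contains_arc rs (cE _ _) E2s E2r.
- by exfalso; apply: (mid s r) => //; left.
- left; move: A1 A2; rewrite {1}r1 => /(arcK _ _ _ _ l2 rs1) h1.
  rewrite r2 a2 => /(arcK _ _ _ _ l1 rs2) h2.
  by rewrite -rE -sE -cprojD; congr cproj; lra.
- right; move: A1 A2; rewrite r2 => /(arcK _ _ _ _ l2 rs2) h1.
  rewrite {1}r1 a2 => /(arcK _ _ _ _ l1 rs1) h2.
  by rewrite -rE -sE -cprojB -[RHS]cprojD1; congr cproj; lra.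
- by exfalso; apply: (mid r (s + 1)) => //; right.
Qed.

(** Suppose that [x] needs the minus sign and [y] the plus sign. The hypothesis
    for the increment [y - x] then gives [K 0 + x = K 0 - x] or
    [K 0 + y = K 0 - y], so that one of them admits both signs. *)
Lemma pointwise_pm_uniform (V : zmodType) (K : V -> V) :
  (forall x t, K (x + t) = K x + t \/ K (x + t) = K x - t) ->
  (forall y, K y = K 0 + y) \/ (forall y, K y = K 0 - y).
Proof.
move=> Kpm; apply: contrapT => /not_orP[/existsNP[x nx] /existsNP[y ny]].
have Kx : K x = K 0 - x by have := Kpm 0 x; rewrite add0r => -[].
have Ky : K y = K 0 + y by have := Kpm 0 y; rewrite add0r => -[].
have := Kpm x (y - x); rewrite addrC subrK Kx Ky => -[].
  move/(congr1 (fun z => z - y + x)); rewrite [y - x]addrC addrA !addrK subrK => K0.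
  by apply: nx; rewrite Kx.
rewrite opprB addrA subrK => K0y.
by apply: ny; rewrite Ky.
Qed.

Lemma torus2_pair_continuous (R : realType) (T : topologicalType) (a b : T -> circle R) :
  continuous a -> continuous b -> continuous (fun t => (a t, b t) : torus2 R).
Proof. by move=> ca cb t; exact: (cvg_pair (ca t) (cb t)). Qed.

Lemma equalizer_closed (T Z : topologicalType) (a b : T -> Z) :
  hausdorff_space Z -> continuous a -> continuous b -> closed [set x | a x = b x].
Proof.
move=> hZ ca cb; rewrite -openC openE => x /= /eqP nab.
move: hZ; rewrite open_hausdorff => /(_ _ _ nab)[[U V] /= [Ua Vb] [oU oV /eqP UV]].
rewrite !inE in Ua Vb; rewrite /interior.
have Ux : \forall y \near x, U (a y) by apply: ca; exact: open_nbhs_nbhs.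
have Vx : \forall y \near x, V (b y) by apply: cb; exact: open_nbhs_nbhs.
apply: filterS2 Ux Vx => y Uy Vy /= aby.
by rewrite -[False]/(@set0 Z (a y)) -UV; split=> //; rewrite aby.
Qed.

Theorem theorem2p2p2 (R : realType)
  (mu : probability (borel (torus2 R)) R) (mu_haar : is_haar mu)
  (g1 : circle R -> circle R) (g1_cont : continuous g1)
  (h : torus2 R -> circle R)
  (f : torus2 R -> torus2 R)
  (fE : forall x y : circle R, f (x, y) = (x + g1 y, h (x, y)))
  (f_homeo : homeomorphism f)
  (f_mu : preserves_measure mu f) :
  exists g2 : circle R -> circle R,
    continuous g2 /\
    ((forall x y : circle R, f (x, y) = (x + g1 y, g2 (x + g1 y) + y)) \/
     (forall x y : circle R, f (x, y) = (x + g1 y, g2 (x + g1 y) - y))).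
Proof.
have [cf [g [cg fK gK]]] := f_homeo.
have f1 z : (f z).1 = z.1 + g1 z.2 by case: z => x y; rewrite fE.
(* The fibre map over u, read in the coordinates (u, y) with u = x + g1 y. *)
pose H u y := h (u - g1 y, y).
have fH u y : f (u - g1 y, y) = (u, H u y) by rewrite fE subrK.
have HE u y : H u y = (f (u - g1 y, y)).2 by rewrite fH.
have cHu u : continuous (H u).
  rewrite (_ : H u = snd \o (f \o (fun y => (u - g1 y, y)))); last first.
    by apply/funext => y; rewrite /= HE.
  move=> y; apply: continuous_comp; last exact: cvg_snd.
  apply: continuous_comp; last exact: cf.
  apply: torus2_pair_continuous => {}y; last exact: cvg_id.
  apply: (@continuous_comp _ _ _ g1 (fun z => u - z)); first exact: g1_cont.
  apply: (@continuous_comp _ _ _ -%R (fun z => u + z)); first exact: circle_opp_continuous.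
  exact: circle_addl_continuous.
have cH y : continuous (H^~ y).
  rewrite (_ : H^~ y = snd \o (f \o (fun u => (u - g1 y, y)))); last first.
    by apply/funext => u; rewrite /= HE.
  move=> u; apply: continuous_comp; last exact: cvg_snd.
  apply: continuous_comp; last exact: cf.
  apply: torus2_pair_continuous ; last by move=> v; exact: cst_continuous.
  exact: circle_addr_continuous.
have gH u y : (g (u, H u y)).2 = y by rewrite -fH fK.
have iH u : injective (H u) by move=> y y' yy; rewrite -(gH u y) yy gH.
have fiber u : (forall y, H u y = H u 0 + y) \/ (forall y, H u y = H u 0 - y).
  apply: pointwise_pm_uniform; apply: expansionless_circle_map => // a l s l' l0 l01 sub.
  apply: (@shear_arc_le R mu g1 f g u a l s l') => // z /sub[y ya <-].
  by rewrite gH.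
(* A point that tells the two signs apart: q and - q differ. The fibres with
   either sign then form two disjoint closed sets covering the connected
   circle. *)
pose q : circle R := cproj (1 / 4).
have qq : q <> - q.
  by rewrite /q -cprojN => /cproj_inj; rewrite ltr_norml => /(_ ltac:(lra)); lra.
pose P := [set u | H u q = H u 0 + q]; pose N := [set u | H u q = H u 0 - q].
have cadd v : continuous (fun u => H u 0 + v).
  move=> u; apply: (@continuous_comp _ _ _ (H^~ 0) (fun z => z + v)); first exact: cH.
  exact: circle_addr_continuous.
have cP : closed P.
  by apply: equalizer_closed; [exact: circle_hausdorff|exact: cH|exact: cadd].
have cN : closed N.
  by apply: equalizer_closed; [exact: circle_hausdorff|exact: cH|exact: cadd].
have PN u : P u -> N u -> False by rewrite /P /N /= => -> /addrI.
have PN' : ~` N = P.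
  rewrite predeqE => u; split; last by move=> Pu /(PN u Pu).
  by move=> nN; case: (fiber u) => Hu; [rewrite /P /= Hu|exfalso; apply: nN; rewrite /N /= Hu].
exists (H^~ 0); split; first exact: cH.
have [[u Pu]|noP] := pselect (P !=set0).
  left => x y; have PT : P = setT.
    apply: (@circle_connected R); first by exists u.
    - by exists P; [rewrite -PN' openC|rewrite setTI].
    - by exists P; rewrite ?setTI.
  have Pv : P (x + g1 y) by rewrite PT.
  rewrite -[x in LHS](addrK (g1 y)) fH; congr pair.
  have [//|Hv] := fiber (x + g1 y).
  by exfalso; apply: (PN _ Pv); rewrite /N /= Hv.
right => x y; rewrite -[x in LHS](addrK (g1 y)) fH; congr pair.
have [Hv|//] := fiber (x + g1 y).
by exfalso; apply: noP; exists (x + g1 y); rewrite /P /= Hv.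
Qed.
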